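(* Let $m, n \in \mathbb{Z} \setminus \{0\}$ and let $\mathrm{BS}(m,n)$ be the Baumslag-Solitar group given by the presentation \[ \mathrm{BS}(m,n) = \langle a, b \mid b^{-1} a^m b = a^n \rangle . \] Then the conjugation quandle $\mathrm{Conj}(\mathrm{BS}(m,n))$ is residually finite (as a quandle) if and only if $|m| = 1$, $|n| = 1$ or $|m| = |n|$.
   Context: A quandle is a non-empty set $Q$ with a binary operation $* : Q \times Q \to Q$ such that: (i) $x * x = x$ for all $x \in Q$; (ii) for all $x, y \in Q$ there exists a unique $z \in Q$ such that $x = z * y$; (iii) $(x * y) * z = (x * z) * (y * z)$ for all $x, y, z \in Q$. A quandle homomorphism is a map $f$ between quandles with $f(x*y) = f(x)*f(y)$ for all $x,y$. For a group $G$, the conjugation quandle $\mathrm{Conj}(G)$ is the set $G$ with the operation $x * y = y^{-1}xy$. A quandle $Q$ is called residually finite if for all $x, y \in Q$ with $x \neq y$ there exist a finite quandle $P$ and a quandle homomorphism $\psi : Q \to P$ such that $\psi(x) \neq \psi(y)$. *)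

(* Defs.v *)
From HB Require Import structures.
From mathcomp Require Import all_boot all_order all_algebra.
From mathcomp Require Import boolp.

Set Implicit Arguments.
Unset Strict Implicit.
Unset Printing Implicit Defensive.

Local Open Scope quotient_scope.
Local Open Scope group_scope.

Reserved Notation "x *q y" (at level 40, left associativity).

HB.mixin Record isQuandle Q := {
  qop : Q -> Q -> Q;
  quandle_inhabited : inhabited Q;
  qopxx : forall x : Q, qop x x = x;
  qop_divP : forall x y : Q, exists! z : Q, x = qop z y;
  qopD : forall x y z : Q, qop (qop x y) z = qop (qop x z) (qop y z)
}.

#[short(type="quandleType")]
HB.structure Definition Quandle := {Q of isQuandle Q}.

#[short(type="finQuandleType")]
HB.structure Definition FinQuandle := {Q of isQuandle Q & Finite Q}.

Notation "x *q y" := (qop x y).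

Definition quandle_hom (Q P : quandleType) (f : Q -> P) : Prop :=
  forall x y : Q, f (x *q y) = f x *q f y.

Definition quandle_residually_finite (Q : quandleType) : Prop :=
  forall x y : Q, x <> y ->
  exists (P : finQuandleType) (psi : Q -> P),
    quandle_hom psi /\ psi x <> psi y.

Definition Conj (G : groupType) : Type := G.

Section ConjQuandle.
Variable G : groupType.

(* [x ^ y] is [y^-1 * (x * y)]. *)
Definition conj_op (x y : Conj G) : Conj G := (x : G) ^ (y : G).

Fact conj_inhabited : inhabited (Conj G).
Proof. exact: (inhabits (1 : G)). Qed.

Fact conj_opxx (x : Conj G) : conj_op x x = x.
Proof. by rewrite /conj_op conjgE mulgA mulVg mul1g. Qed.

Fact conj_op_divP (x y : Conj G) : exists! z : Conj G, x = conj_op z y.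
Proof.
exists ((x : G) ^ (y : G)^-1); split; first by rewrite /conj_op conjgKV.
by move=> z ->; rewrite /conj_op conjgK.
Qed.

Fact conj_opD (x y z : Conj G) :
  conj_op (conj_op x y) z = conj_op (conj_op x z) (conj_op y z).
Proof. exact: conjJg. Qed.

HB.instance Definition _ := isQuandle.Build (Conj G)
  conj_inhabited conj_opxx conj_op_divP conj_opD.
End ConjQuandle.

(* The letter [(x, false)] stands for the generator x and [(x, true)] for its
   formal inverse. *)
Definition word (X : Type) := seq (X * bool).

Definition word_inv (X : Type) (w : word X) : word X :=
  rev [seq (l.1, ~~ l.2) | l <- w].

Definition word_expz (X : Type) (x : X) (k : int) : word X :=
  match k with
  | Posz i => nseq i (x, false)
  | Negz i => nseq i.+1 (x, true)
  end.

(* A presentation is a set [R] of pairs of words; [R u v] is the defining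
   relation u = v.  Since words are in the letters x and x^-1, the quotient of
   the monoid of words by [pres_eq R] is the quotient of the free group on [X]
   by the normal closure of the elements u v^-1. *)
Inductive pres_eq (X : Type) (R : word X -> word X -> Prop) :
    word X -> word X -> Prop :=
| pres_rel u v : R u v -> pres_eq R u v
| pres_cancel x e : pres_eq R [:: (x, e); (x, ~~ e)] [::]
| pres_cat u u' v v' :
    pres_eq R u u' -> pres_eq R v v' -> pres_eq R (u ++ v) (u' ++ v')
| pres_refl u : pres_eq R u u
| pres_sym u v : pres_eq R u v -> pres_eq R v u
| pres_trans u v w : pres_eq R u v -> pres_eq R v w -> pres_eq R u w.

Section PresentedGroup.
Variables (X : choiceType) (R : word X -> word X -> Prop).

Definition pres_eqb (u v : word X) : bool := `[< pres_eq R u v >].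

Fact pres_eqb_refl : reflexive pres_eqb.
Proof. by move=> u; apply/asboolP; apply: pres_refl. Qed.

Fact pres_eqb_sym : symmetric pres_eqb.
Proof.
by move=> u v; apply/asboolP/asboolP => H; apply: pres_sym.
Qed.

Fact pres_eqb_trans : transitive pres_eqb.
Proof.
by move=> v u w /asboolP uv /asboolP vw; apply/asboolP; apply: pres_trans vw.
Qed.

Canonical pres_equiv := EquivRel pres_eqb pres_eqb_refl pres_eqb_sym
  pres_eqb_trans.

Definition presented : Type := {eq_quot pres_equiv}.

HB.instance Definition _ := Choice.on presented.
HB.instance Definition _ := EqQuotient.on presented.

Lemma presentedP (u v : word X) :
  \pi_presented u = \pi_presented v <-> pres_eq R u v.
Proof.
split=> [/eqP|uv]; first by rewrite piE => /asboolP.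
by apply/eqP; rewrite piE; apply/asboolP.
Qed.

Lemma pres_eq_repr (u : word X) : pres_eq R (repr (\pi_presented u)) u.
Proof. by apply/presentedP; rewrite reprK. Qed.

Definition pres_one : presented := \pi_presented [::].
Definition pres_mul (g h : presented) : presented :=
  \pi_presented (repr g ++ repr h).
Definition pres_inv (g : presented) : presented :=
  \pi_presented (word_inv (repr g)).

Lemma pres_mul_pi (u v : word X) :
  pres_mul (\pi_presented u) (\pi_presented v) = \pi_presented (u ++ v).
Proof. by apply/presentedP; apply: pres_cat; apply: pres_eq_repr. Qed.

Lemma word_invK : involutive (@word_inv X).
Proof.
move=> u; rewrite /word_inv map_rev revK -map_comp map_id_in //.
by move=> [x e] _ /=; rewrite negbK.
Qed.

Lemma word_mulVg (u : word X) : pres_eq R (word_inv u ++ u) [::].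
Proof.
elim: u => [|[x e] u IHu]; first exact: pres_refl.
rewrite /word_inv /= rev_cons cat_rcons.
apply: pres_trans IHu; apply: pres_cat; first exact: pres_refl.
rewrite -[X in pres_eq _ _ X]cat0s -[_ :: _ :: u]/([:: _; _] ++ u).
apply: pres_cat; last exact: pres_refl.
by have := pres_cancel R x (~~ e); rewrite negbK.
Qed.

Fact pres_mulA : associative pres_mul.
Proof.
move=> f g h; rewrite -[f]reprK -[g]reprK -[h]reprK.
by rewrite 2!(pres_mul_pi (repr _) (repr _)) 2!pres_mul_pi catA.
Qed.

Fact pres_mul1g : left_id pres_one pres_mul.
Proof. by move=> g; rewrite -[g]reprK pres_mul_pi. Qed.

Fact pres_mulg1 : right_id pres_one pres_mul.
Proof. by move=> g; rewrite -[g]reprK pres_mul_pi cats0. Qed.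

Fact pres_mulVg : left_inverse pres_one pres_inv pres_mul.
Proof.
move=> g; rewrite -[in X in pres_mul _ X](reprK g) pres_mul_pi.
by apply/presentedP; apply: word_mulVg.
Qed.

Fact pres_mulgV : right_inverse pres_one pres_inv pres_mul.
Proof.
move=> g; rewrite -[in X in pres_mul X _](reprK g) pres_mul_pi.
apply/presentedP; rewrite -[X in pres_eq R (X ++ _)]word_invK.
exact: word_mulVg.
Qed.

HB.instance Definition _ := isGroup.Build presented
  pres_mulA pres_mul1g pres_mulg1 pres_mulVg pres_mulgV.

Definition pres_gen (x : X) : presented := \pi_presented [:: (x, false)].

End PresentedGroup.

Definition eval_word (X : Type) (G : groupType) (f : X -> G) (w : word X) : G :=
  \prod_(l <- w) (if l.2 then (f l.1)^-1 else f l.1).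

Section UniversalProperty.
Variables (X : choiceType) (R : word X -> word X -> Prop).

Lemma eval_pres_gen (u : word X) :
  eval_word (@pres_gen X R) u = \pi_(presented R) u.
Proof.
elim: u => [|[x e] u IHu]; rewrite /eval_word ?big_nil ?big_cons //=.
rewrite -/(eval_word _ u) IHu -cat1s -pres_mul_pi; congr (_ * _).
case: e => //; apply: (@mulgI _ (pres_gen R x)); rewrite mulgV.
apply/esym; rewrite [LHS]pres_mul_pi; apply/presentedP; exact: pres_cancel.
Qed.

Lemma pres_genP (u v : word X) :
  R u v -> eval_word (@pres_gen X R) u = eval_word (@pres_gen X R) v.
Proof. by move=> uv; rewrite !eval_pres_gen; apply/presentedP/pres_rel. Qed.

Variables (G : groupType) (f : X -> G).

Lemma pres_lift_exists :
  (forall u v, R u v -> eval_word f u = eval_word f v) ->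
  exists h : presented R -> G,
    {morph h : x y / x * y} /\ forall x, h (pres_gen R x) = f x.
Proof.
move=> fR; have evalR u v : pres_eq R u v -> eval_word f u = eval_word f v.
  elim=> {u v} [u v /fR //|x e|u u' v v' _ IHu _ IHv|//|u v _ -> //|].
  - by rewrite /eval_word !big_cons !big_nil mulg1; case: e; rewrite ?mulVg ?mulgV.
  - by rewrite /eval_word !big_cat /= -!/(eval_word _ _) IHu IHv.
  - by move=> u v w _ -> _ ->.
exists (fun g => eval_word f (repr g)); split=> [g h | x].
- by rewrite (evalR _ _ (pres_eq_repr _ _)) /eval_word big_cat.
- by rewrite (evalR _ _ (pres_eq_repr _ _)) /eval_word big_seq1.
Qed.

Lemma pres_lift_unique (h h' : presented R -> G) :
  {morph h : x y / x * y} -> {morph h' : x y / x * y} ->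
  (forall x, h (pres_gen R x) = h' (pres_gen R x)) -> h =1 h'.
Proof.
move=> hM h'M hh' g; rewrite -[g]reprK -eval_pres_gen.
have m1 (k : presented R -> G) : {morph k : x y / x * y} -> k 1 = 1.
  by move=> kM; apply: (@mulgI _ (k 1)); rewrite -kM !mulg1.
have mV (k : presented R -> G) : {morph k : x y / x * y} ->
    forall y, k y^-1 = (k y)^-1.
  by move=> kM y; apply: (@mulgI _ (k y)); rewrite -kM !mulgV m1.
elim: (repr g) => [|[x e] u IHu]; rewrite /eval_word ?big_nil ?big_cons.
  by rewrite !m1.
by rewrite -/(eval_word _ u) hM h'M IHu; case: e; rewrite /= ?mV // hh'.
Qed.

End UniversalProperty.

Inductive BS_gen := BS_a | BS_b.

Definition bool_of_BS_gen (x : BS_gen) : bool :=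
  if x is BS_a then true else false.
Definition BS_gen_of_bool (c : bool) : BS_gen := if c then BS_a else BS_b.

Fact bool_of_BS_genK : cancel bool_of_BS_gen BS_gen_of_bool.
Proof. by case. Qed.

HB.instance Definition _ := Choice.copy BS_gen (can_type bool_of_BS_genK).

Variant BS_rel (m n : int) : word BS_gen -> word BS_gen -> Prop :=
| BS_rel_conj :
    BS_rel m n ([:: (BS_b, true)] ++ word_expz BS_a m ++ [:: (BS_b, false)])
               (word_expz BS_a n).

Definition BS (m n : int) : groupType := presented (BS_rel m n).

(* Main.v *)
Require Import Defs.
From mathcomp Require Import all_boot all_order all_algebra.
From HB Require Import structures.
From mathcomp Require Import all_fingroup.
From mathcomp Require Import boolp.
From mathcomp Require Import zify ring.

Local Open Scope ring_scope.

Set Implicit Arguments.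
Unset Strict Implicit.
Unset Printing Implicit Defensive.

Import Order.TTheory GRing.Theory Num.Theory.

(** Write [G] for BS(m, n), with its generators [a] and [b].

    If |m| = 1, |n| = 1 or |m| = |n|, then every [g <> 1] in [G] is moved by a
    morphism from [G] to a finite permutation group ([BS_fin_separated]), and
    such a morphism is also a morphism of conjugation quandles.  Exchanging
    [m] and [n], or changing both signs, reduces to m = 1 and to n = m or
    n = - m.
    - When m = 1, every element is [b^i a^k b^-j].  If [i <> j], a cyclic
      quotient in which [a] is trivial moves it; otherwise it is a conjugate
      of [a^k], and [a^k] is moved by an affine action of [G] on the integers
      modulo (k n)^2 + 1, where [n] is invertible ([BS1_fin_separated]).
    - When n = m or n = - m, every element is a reduced product
      [a^r1 b^e1 ... a^rs b^es a^t].  If s = 0 an affine action moves it.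
      Otherwise follow a point on which [a] acts as a cycle of length |m|,
      changing cycle at each letter [b^e]: reducedness says exactly that the
      conditions put on [b] define a partial injection, which extends to a
      permutation ([BS_level_quotient], [BS_eq_fin_separated]).

    Conversely, let [psi] be a quandle morphism from Conj([G]) to a finite
    quandle.  Identify two elements of [G] when their conjugation actions
    agree after [psi]; this is a congruence, and since [psi (x ^ g)] depends
    only on [psi x] and [psi g], some positive power of [a] is congruent to 1.
    If [r] is the order of [a] modulo the congruence, the relation forces
    gcd(m, r) to divide [n], so that with d = gcd(m, n) the power [a^d] is
    congruent to some [a^(m k)], and [b^-1 a^d b] to [a^(n k)].  Hence [psi]
    takes the same value at [a] and at its conjugate by [b^-1 a^d b]
    ([BS_quandle_collapse]).  If |m|, |n| > 1 and |m| <> |n|, then, up to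
    exchanging [m] and [n], [m] does not divide [n], so 0 < d < |m|; an
    explicit action of [G] on pairs of an integer and a natural number then
    shows that these two elements of [G] differ ([BS_conj_neq]). *)

(** * Integer powers in a group *)

(** [x ^z k] is the [k]-th power of [x], for [k] an integer. *)
Definition expgz (G : groupType) (x : G) (k : int) : G :=
  match k with
  | Posz i => (x ^+ i)%g
  | Negz i => (x ^- i.+1)%g
  end.

Local Notation "x ^z k" := (expgz x k) (at level 29, left associativity).

Section IntegerPowers.
Local Open Scope group_scope.

Variable G : groupType.
Implicit Types (x y g : G) (i j k : int).

Lemma int_up_down_ind (P : int -> Prop) :
    P 0%R -> (forall k, P k -> P (k + 1)%R) -> (forall k, P k -> P (k - 1)%R) ->
  forall k, P k.
Proof.
move=> P0 PS PB; elim=> // k Pk; rewrite intS.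
  by rewrite addrC; apply: PS.
by rewrite opprD addrC; apply: PB.
Qed.

Lemma expgzS x k : x ^z (k + 1)%R = x ^z k * x.
Proof.
case: k => [k|[|k]]; first by rewrite /= addn1 expgSr.
  by rewrite /= mulVg.
have -> : (Negz k.+1 + 1)%R = Negz k by lia.
by rewrite /= (expgS x k.+1) invgM mulgVK.
Qed.

Lemma expgzB1 x k : x ^z (k - 1)%R = x ^z k * x^-1.
Proof. by rewrite -[in RHS](subrK 1%R k) expgzS mulgK. Qed.

Lemma expgzD x i j : x ^z (i + j)%R = x ^z i * x ^z j.
Proof.
elim/int_up_down_ind: j => [|j IHj|j IHj]; first by rewrite addr0 mulg1.
  by rewrite addrA !expgzS IHj mulgA.
rewrite addrA !expgzB1 IHj -mulgA; congr (_ * _).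
Qed.

Lemma expgzN x k : x ^z (- k)%R = (x ^z k)^-1.
Proof. by apply: (mulgI (x ^z k)); rewrite -expgzD subrr mulgV. Qed.

Lemma expgzM x i j : x ^z (i * j)%R = (x ^z i) ^z j.
Proof.
elim/int_up_down_ind: j => [|j IHj|j IHj]; first by rewrite mulr0.
  by rewrite mulrDr mulr1 expgzS expgzD IHj.
by rewrite mulrDr mulrN1 expgzB1 expgzD IHj expgzN.
Qed.

Lemma expgz_intertwine x y g k : x * g = g * y -> x ^z k * g = g * y ^z k.
Proof.
move=> xg; elim/int_up_down_ind: k => [|k IHk|k IHk].
  by rewrite mul1g mulg1.
  by rewrite !expgzS -mulgA xg mulgA IHk -mulgA.
have xVg : x^-1 * g = g * y^-1.
  by apply: (mulgI x); apply: (mulIg y); rewrite !mulgA mulgV mul1g xg mulgVK.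
by rewrite !expgzB1 -mulgA xVg mulgA IHk -mulgA.
Qed.

Lemma expgz_intertwineV x y g : x * g = g * y -> y * g^-1 = g^-1 * x.
Proof. by move=> xg; apply: (mulgI g); rewrite mulVKg mulgA -xg mulgK. Qed.

(** A power of [x] moves along an orbit indexed by the integers once [x]
    itself does. *)
Lemma expgz_act (V : Type) (act : V -> G -> V) x (f : int -> V) :
    (forall v g h, act v (g * h) = act (act v g) h) ->
    (forall v, act v 1 = v) ->
    (forall k, act (f k) x = f (k + 1)%R) ->
  forall i k, act (f i) (x ^z k) = f (i + k)%R.
Proof.
move=> actM act1 fx i k.
have fxV j : act (f j) x^-1 = f (j - 1)%R.
  by rewrite -[in LHS](subrK 1%R j) -fx -actM mulgV act1.
elim/int_up_down_ind: k => [|k IHk|k IHk]; first by rewrite act1 addr0.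
  by rewrite expgzS actM IHk fx addrA.
by rewrite expgzB1 actM IHk fxV addrA.
Qed.

End IntegerPowers.

Section Morphisms.
Local Open Scope group_scope.

Variables (G H : groupType) (h : G -> H).
Hypothesis hM : {morph h : x y / x * y}.

Lemma morph_mul1 : h 1 = 1.
Proof. by apply: (@mulgI _ (h 1)); rewrite -hM !mulg1. Qed.

Lemma morph_mulV x : h x^-1 = (h x)^-1.
Proof. by apply: (@mulgI _ (h x)); rewrite -hM !mulgV morph_mul1. Qed.

Lemma morph_expg x k : h (x ^+ k) = h x ^+ k.
Proof. by elim: k => [|k IHk]; rewrite ?morph_mul1 // !expgS hM IHk. Qed.

Lemma morph_expgz x k : h (x ^z k) = h x ^z k.
Proof. by case: k => k; rewrite /expgz ?morph_mulV morph_expg. Qed.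

End Morphisms.

(** * The group of bijections of an arbitrary type *)

(** Bijections of [T] onto itself, composed from left to right as permutations
    are, so that they act on [T] on the right. *)
Record selfbij (T : Type) := SelfBij {
  sb_fun :> T -> T;
  sb_inv : T -> T;
  sb_funK : cancel sb_fun sb_inv;
  sb_invK : cancel sb_inv sb_fun }.

HB.instance Definition _ (T : Type) := gen_eqMixin (selfbij T).
HB.instance Definition _ (T : Type) := gen_choiceMixin (selfbij T).

Section SelfBijections.
Variable T : Type.
Implicit Types f g : selfbij T.

Lemma selfbij_ext f g : f =1 g -> f = g.
Proof.
case: f g => [f f' fK f'K] [g g' gK g'K] /= fg.
have {fg} fg : f = g by apply: funext.
case: _ / fg gK g'K => gK g'K.
have f'g' : f' = g' by apply: funext => x; rewrite -[in LHS](g'K x) fK.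
case: _ / f'g' gK g'K => gK g'K.
by congr SelfBij; apply: Prop_irrelevance.
Qed.

Definition selfbij_one : selfbij T := @SelfBij T id id (frefl _) (frefl _).
Definition selfbij_mul f g : selfbij T :=
  SelfBij (can_comp (sb_funK g) (sb_funK f)) (can_comp (sb_invK f) (sb_invK g)).
Definition selfbij_inv f : selfbij T := SelfBij (sb_invK f) (sb_funK f).

Fact selfbij_mulA : associative selfbij_mul.
Proof. by move=> f g h; apply: selfbij_ext. Qed.

Fact selfbij_mul1 : left_id selfbij_one selfbij_mul.
Proof. by move=> f; apply: selfbij_ext. Qed.

Fact selfbij_mulr1 : right_id selfbij_one selfbij_mul.
Proof. by move=> f; apply: selfbij_ext. Qed.

Fact selfbij_mulV : left_inverse selfbij_one selfbij_inv selfbij_mul.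
Proof. by move=> f; apply: selfbij_ext => x; apply: sb_invK. Qed.

Fact selfbij_mulrV : right_inverse selfbij_one selfbij_inv selfbij_mul.
Proof. by move=> f; apply: selfbij_ext => x; apply: sb_funK. Qed.

HB.instance Definition _ := isGroup.Build (selfbij T)
  selfbij_mulA selfbij_mul1 selfbij_mulr1 selfbij_mulV selfbij_mulrV.

End SelfBijections.

(** * Baumslag-Solitar groups, abstractly *)

(** [is_BS a b m n] says that [a] and [b] present the group [G] as BS(m, n):
    they generate [G] as a monoid together with their inverses, they satisfy
    the defining relation, and any two elements of any group that satisfy it
    are the images of [a] and [b] under a morphism.  The relation is written
    without inverses.  Unlike the presentation, this notion has evident
    symmetries in [m] and [n]. *)
Definition is_BS (G : groupType) (a b : G) (m n : int) : Prop :=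
  [/\ forall P : G -> Prop, P 1%g ->
        (forall g, P g -> [/\ P (a * g)%g, P (a^-1 * g)%g,
                              P (b * g)%g & P (b^-1 * g)%g]) ->
        forall g, P g,
      (a ^z m * b)%g = (b * a ^z n)%g
    & forall (H : groupType) (A B : H), (A ^z m * B = B * A ^z n)%g ->
        exists h : G -> H, [/\ {morph h : x y / x * y}%g, h a = A & h b = B]].

Lemma is_BS_opp (G : groupType) (a b : G) m n :
  is_BS a b m n -> is_BS a b (- m) (- n).
Proof.
have relN (H : groupType) (A B : H) k l :
    (A ^z k * B = B * A ^z l -> A ^z (- k)%R * B = B * A ^z (- l)%R)%g.
  rewrite -(mulrN1 k) -(mulrN1 l) !expgzM.
  exact: expgz_intertwine.
case=> gen rel univ; split=> //; first exact: relN.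
by move=> H A B /relN; rewrite !opprK => /univ.
Qed.

Lemma is_BS_swap (G : groupType) (a b : G) m n :
  is_BS a b m n -> is_BS a b^-1%g n m.
Proof.
case=> gen rel univ; split.
- by move=> P P1 PM; apply: gen => // g /PM; rewrite invgK; case.
- exact: expgz_intertwineV.
- move=> H A B /expgz_intertwineV /univ[h [hM ha hb]].
  by exists h; split=> //; rewrite morph_mulV // hb invgK.
Qed.

Lemma eval_word_expz (X : Type) (G : groupType) (f : X -> G) (x : X) k :
  eval_word f (word_expz x k) = f x ^z k.
Proof.
have evalX y i : (\prod_(l <- nseq i y)
    (if l.2 then (f l.1)^-1 else f l.1) =
    (if y.2 then (f y.1)^-1 else f y.1) ^+ i)%g.
  by elim: i => [|i IHi]; rewrite /= ?big_nil // big_cons IHi expgS.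
by rewrite /eval_word; case: k => k; rewrite /word_expz evalX //= expVgn.
Qed.

Lemma BS_is_BS (m n : int) :
  @is_BS (BS m n) (pres_gen _ BS_a) (pres_gen _ BS_b) m n.
Proof.
set a := pres_gen _ BS_a; set b := pres_gen _ BS_b.
have evalR (H : groupType) (f : BS_gen -> H) :
  eval_word f ([:: (BS_b, true)] ++ word_expz BS_a m ++ [:: (BS_b, false)])
    = ((f BS_b)^-1 * (f BS_a ^z m * f BS_b))%g.
  by rewrite /eval_word !big_cat /= -!/(eval_word _ _) eval_word_expz
     /eval_word !big_seq1.
split.
- move=> P P1 PM g; rewrite -[g]reprK -eval_pres_gen.
  elim: (generic_quotient.repr g) => [|[x e] u IHu];
    rewrite /eval_word ?big_nil ?big_cons //.
  rewrite -/(eval_word _ u).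
  by case: (PM _ IHu); case: x; case: e.
- have := pres_genP (BS_rel_conj m n).
  by rewrite evalR eval_word_expz -/a -/b => <-; rewrite mulVKg.
- move=> H A B AB.
  have [|h [hM hx]] := @pres_lift_exists _ (BS_rel m n) H
      (fun x => if x is BS_a then A else B).
    by move=> _ _ [] ; rewrite evalR eval_word_expz AB mulKg.
  by exists h; rewrite /a /b !hx.
Qed.

(** * Separation by finite permutation groups *)

(** Some morphism to a finite permutation group does not kill [g]. *)
Definition fin_separated (G : groupType) (g : G) : Prop :=
  exists (V : finType) (h : G -> {perm V}),
    {morph h : x y / x * y}%g /\ h g <> 1%g.

HB.instance Definition _ (F : finGroupType) := Finite.copy (Conj F) F.

Lemma Conj_residually_finite (G : groupType) :
  (forall g : G, g <> 1%g -> fin_separated g) ->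
  quandle_residually_finite (Conj G).
Proof.
move=> sepG x y xy.
have [|V [h [hM hxy]]] := sepG ((x : G) * (y : G)^-1)%g.
  by move/divg1_eq.
exists (Conj {perm V} : finQuandleType), (h : Conj G -> Conj {perm V}); split.
  move=> u v; rewrite /qop /= /conj_op !conjgE !hM.
  by rewrite (morph_mulV hM).
by move=> hxhy; apply: hxy; rewrite hM (morph_mulV hM) hxhy mulgV.
Qed.

Lemma perm_expgz_orbit (V : finType) (A : {perm V}) (f : int -> V) :
  (forall k, A (f k) = f (k + 1)) ->
  forall i k, (A ^z k)%g (f i) = f (i + k).
Proof.
move=> Af; apply: (@expgz_act _ _ (fun v (g : {perm V}) => g v)) => //.
  by move=> v g h; rewrite permM.
by move=> v; rewrite perm1.
Qed.

(** Modulo c^2 + 1 the integer [c] is invertible, hence so are its divisors. *)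
Lemma Zp_sqr_succ (c : int) :
  c <> 0 -> c%:~R ^+ 2 + 1 = 0 :> 'Z_((`|c| ^ 2).+1).
Proof.
move=> c0; set N := (`|c| ^ 2).+1.
have cN : c ^+ 2 + 1 = N%:Z by rewrite /N; nia.
have := congr1 (fun z : int => z%:~R : 'Z_N) cN.
by rewrite /= intrD rmorphXn /= => ->; apply: pchar_Zp; lia.
Qed.

Lemma perm_expgz_shift (N : nat) (A : {perm 'Z_N}) k :
  (forall v, A v = v + 1) -> forall v, (A ^z k)%g v = v + k%:~R.
Proof.
move=> Av v.
have := @perm_expgz_orbit _ A (fun i => v + i%:~R) _ 0 k.
by rewrite addr0 add0r; apply=> i; rewrite Av intrD addrA.
Qed.

Section AffineQuotients.

Variables (G : groupType) (a b : G) (m n : int).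
Hypothesis BSab : is_BS a b m n.

(** The group BS(m, n) acts on the integers modulo [N] by the affine maps
    [x |-> x + 1] for [a] and [x |-> u x] for [b] when [u m = n]. *)
Lemma BS_affine (N : nat) (u u' : 'Z_N) :
    u * u' = 1 -> m%:~R * u = n%:~R ->
  exists h : G -> {perm 'Z_N}, {morph h : x y / x * y}%g /\
    forall k v, h (a ^z k)%g v = v + k%:~R.
Proof.
move=> uu' mu_n.
have uI : injective ( *%R^~ u).
  by apply: (can_inj (g := *%R^~ u')) => v /=; rewrite -mulrA uu' mulr1.
pose A : {perm 'Z_N} := perm (addIr 1); pose B : {perm 'Z_N} := perm uI.
have Av k v : (A ^z k)%g v = v + k%:~R.
  by apply: perm_expgz_shift => w; rewrite permE.
case: BSab => _ _ /(_ {perm 'Z_N} A B)[].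
  by apply/permP => v; rewrite !permM !Av !permE mulrDl mu_n.
by move=> h [hM ha _]; exists h; split=> // k v; rewrite morph_expgz // ha.
Qed.

(** The factor [s] leaves room to choose the modulus so that [n / m] makes
    sense in it. *)
Lemma BS_expgz_separated (k s : int) :
    k <> 0 -> s <> 0 ->
    (exists u u' : 'Z_((`|(k * s)%R| ^ 2).+1),
      u * u' = 1 /\ m%:~R * u = n%:~R) ->
  fin_separated (a ^z k)%g.
Proof.
move=> k0 s0 [u [u' [uu' mu]]]; have [h [hM hk]] := BS_affine uu' mu.
exists 'Z_((`|(k * s)%R| ^ 2).+1), h; split=> // /permP/(_ 0).
rewrite hk perm1 add0r => k_eq0.
have /Zp_sqr_succ/eqP : k * s <> 0 by lia.
by rewrite intrM k_eq0 mul0r expr0n add0r oner_eq0.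
Qed.

End AffineQuotients.

(** * The groups BS(1, n) *)

Section BSOne.

Variables (G : groupType) (a b : G) (n : int).
Hypothesis BSab : is_BS a b 1 n.
Hypothesis n_neq0 : n <> 0.

(** As [a b = b a^n], powers of [b] move to the left and those of [b^-1] to
    the right. *)
Lemma BS1_expgz_b (k : int) (i : nat) :
  (a ^z k * b ^+ i = b ^+ i * a ^z (n ^+ i * k)%R)%g.
Proof.
case: BSab => _ rel _.
elim: i k => [|i IHi] k; first by rewrite mul1r mul1g mulg1.
rewrite expgSr mulgA IHi -mulgA (expgz_intertwine _ rel) -expgzM.
by rewrite mulgA exprS mulrA.
Qed.

Lemma BS1_normal_form (g : G) :
  exists (i j : nat) (k : int), g = (b ^+ i * a ^z k * b ^- j)%g.
Proof.
have amul i j k l : (a ^z l * (b ^+ i * a ^z k * b ^- j) =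
    b ^+ i * a ^z (n ^+ i * l + k)%R * b ^- j)%g.
  by rewrite !mulgA BS1_expgz_b expgzD !mulgA.
case: BSab => gen rel _; elim/gen: g => [|_ [i [j [k ->]]]].
  by exists 0, 0, 0; rewrite !mul1g invg1.
split.
- by exists i, j, (n ^+ i * 1 + k); rewrite -amul.
- by exists i, j, (n ^+ i * -1 + k); rewrite -amul.
- by exists i.+1, j, k; rewrite expgS !mulgA.
- case: i => [|i]; last by exists i, j, k; rewrite expgS -!mulgA mulKg.
  exists 0, j.+1, (n * k); rewrite !mul1g expgSr invgM !mulgA; congr (_ * _)%g.
  by apply: (mulgI b); rewrite mulVKg mulgA expgzM
    -(expgz_intertwine k rel) mulgK.
Qed.

Lemma BS1_fin_separated (g : G) : g <> 1%g -> fin_separated g.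
Proof.
have [i [j [k ->]]] := BS1_normal_form g.
have [<- g1|/eqP ij _] := eqVneq i j.
  have k0 : k <> 0 by move=> k0; apply: g1; rewrite k0 mulg1 mulgV.
  have [|V [h [hM hk]]] := BS_expgz_separated BSab k0 n_neq0.
    have kn0 : k * n <> 0 by lia.
    exists n%:~R, (- (k%:~R ^+ 2 * n%:~R)); split; last by rewrite mul1r.
    have := Zp_sqr_succ kn0; rewrite intrM.
    (* modulo (k n)^2 + 1 the inverse of n is - k^2 n *)
    move=> /eqP; rewrite addr_eq0 => /eqP kn1.
    by rewrite mulrN mulrCA -expr2 -exprMn kn1 opprK.
  exists V, h; split=> // hg; apply: hk; apply: (mulgI (h (b ^+ i)%g)).
  apply: (mulIg (h (b ^- i)%g)); rewrite mulg1 -!hM hg mulgV.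
  by rewrite morph_mul1.
(* The two powers of b do not balance: kill a. *)
pose c : int := i%:Z - j%:Z; pose N := (`|c| ^ 2).+1.
pose B : {perm 'Z_N} := perm (addIr 1).
have exp1z k' : (1 ^z k' = 1 :> {perm 'Z_N})%g.
  by case: k' => l; rewrite /expgz expg1n ?invg1.
case: BSab => _ _ /(_ {perm 'Z_N} 1%g B)[]; first by rewrite !exp1z mulg1 mul1g.
move=> h [hM ha hb]; exists 'Z_N, h; split=> //.
rewrite !hM (morph_expgz hM) ha exp1z mulg1 (morph_mulV hM) !(morph_expg hM) hb.
rewrite (_ : _ * _ = B ^z c)%g; last by rewrite expgzD expgzN.
have Bv v : B v = v + 1 by rewrite permE.
move=> /permP/(_ 0); rewrite (perm_expgz_shift _ Bv) perm1 add0r => c0.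
have /Zp_sqr_succ/eqP : c <> 0 by rewrite /c; lia.
by rewrite c0 expr0n add0r oner_eq0.
Qed.

End BSOne.

(** * The groups BS(m, n) with |m| = |n| > 1 *)

Lemma intr_Zp_eq0 (m r : int) :
  (1 < `|m|)%N -> (r%:~R == 0 :> 'Z_`|m|) = (m %| r)%Z.
Proof.
move=> m_gt1; have mE : m%:~R = 0 :> 'Z_`|m|.
  have M0 : (`|m|%N%:Z)%:~R = 0 :> 'Z_`|m| by apply: pchar_Zp.
  have /(congr1 (fun z : int => z%:~R : 'Z_`|m|)) :
    m = sgz m * `|m|%N%:Z by lia.
  by rewrite intrM M0 mulr0.
apply/idP/idP => [|/dvdzP[q ->]]; last by rewrite intrM mE mulr0.
have m0 : m != 0 by lia.
rewrite {1}(divz_eq r m) intrD intrM mE mulr0 add0r.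
have r0 := modz_ge0 r m0; have rm := ltz_mod r m0.
have [x xE] : exists x : nat, (r %% m)%Z = x by exists `|(r %% m)%Z|%N; lia.
rewrite xE in rm *; move=> /eqP/(congr1 val).
rewrite [LHS](val_Zp_nat m_gt1) modn_small => [|]; last by lia.
by move=> /= x0; apply/dvdz_mod0P; rewrite xE x0.
Qed.

(** A partial injection of a finite type into itself extends to a
    permutation. *)
Lemma perm_extending (V : finType) (s t : seq V) :
  uniq s -> uniq t -> size s = size t -> exists p : {perm V}, map p s = t.
Proof.
elim: s t => [|x s IHs] [|y t] //; first by exists 1%g.
move=> /andP[xs us] /andP[yt ut] [/(IHs _ us ut)[p pst]].
exists (p * tperm (p x) y)%g; rewrite /= permM tpermL; congr cons.
rewrite -pst; apply/eq_in_map => z zs; rewrite permM tpermD //.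
  by apply: contraNneq xs => /perm_inj ->.
by apply: contraNneq yt => ->; rewrite -pst map_f.
Qed.

Section BSEqual.

Variables (G : groupType) (a b : G) (m eps : int).
Hypothesis BSab : is_BS a b m (eps * m).
Hypothesis eps2 : eps * eps = 1.
Hypothesis m_gt1 : (1 < `|m|)%N.

(** A syllable [(r, e)] stands for [a^r b], or [a^r b^-1] when [e] is true;
    [syl_val s t] is the product of the syllables of [s], followed by
    [a^t]. *)
Definition syl_b (e : bool) : G := if e then b^-1%g else b.

Definition syl_val (s : seq (int * bool)) (t : int) : G :=
  foldr (fun x g => a ^z x.1 * syl_b x.2 * g)%g (a ^z t) s.

(** Consecutive syllables are reduced unless they contain [b a^r b^-1] or
    [b^-1 a^r b] with [r] a multiple of [m]. *)
Definition syl_red (x y : int * bool) : bool :=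
  ~~ ((m %| y.1)%Z && (x.2 != y.2)).

(** [a^m] commutes with [b], or is inverted by it. *)
Lemma expgz_syl_b (e : bool) (r : int) : (m %| r)%Z ->
  (a ^z r * syl_b e = syl_b e * a ^z (eps * r)%R)%g.
Proof.
move=> /dvdzP[q ->]; case: BSab => _ rel _.
have relq k : (a ^z (m * k)%R * b = b * a ^z (eps * m * k)%R)%g.
  by rewrite !expgzM; apply: expgz_intertwine; rewrite -expgzM.
case: e => /=; last by rewrite [q * m]mulrC relq -mulrA.
have -> : q * m = eps * m * (eps * q).
  by rewrite -[LHS]mul1r -eps2; ring.
have -> : eps * (eps * m * (eps * q)) = m * (eps * q).
  by rewrite -[RHS]mul1r -eps2; ring.
exact: expgz_intertwineV.
Qed.

Lemma expgz_syl_val (k : int) s t : sorted syl_red s ->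
  exists s' t', sorted syl_red s' /\ (a ^z k * syl_val s t)%g = syl_val s' t'.
Proof.
case: s => [_|[r e] s reds]; first by exists [::], (k + t); rewrite /= expgzD.
exists ((k + r, e) :: s), t; rewrite /= expgzD !mulgA; split=> //.
by case: s reds.
Qed.

Lemma syl_b_val (e : bool) s t : sorted syl_red s ->
  exists s' t', sorted syl_red s' /\ (syl_b e * syl_val s t)%g = syl_val s' t'.
Proof.
case: s => [_|[r f] s reds]; first by exists [:: (0, e)], t; rewrite /= mul1g.
have [red|] := boolP (syl_red (0, e) (r, f)).
  by exists [:: (0, e), (r, f) & s], t; rewrite /= red mul1g.
rewrite negbK => /andP[/= /expgz_syl_b rE ef].
have [|s' [t' [reds' sE]]] := @expgz_syl_val (eps * r) s t.
  exact: path_sorted reds.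
have bb : (syl_b e * syl_b f = 1)%g.
  by case: (e) (f) ef => [] [] //= _; rewrite ?mulVg ?mulgV.
by exists s', t'; split=> //; rewrite -sE rE !mulgA bb mul1g.
Qed.

Lemma syl_normal_form (g : G) :
  exists s t, sorted syl_red s /\ g = syl_val s t.
Proof.
case: BSab => gen _ _; elim/gen: g => [|_ [s [t [reds ->]]]].
  by exists [::], 0.
split.
- exact: (expgz_syl_val 1 t reds).
- exact: (expgz_syl_val (-1) t reds).
- exact: (syl_b_val false t reds).
- exact: (syl_b_val true t reds).
Qed.

(** Points are pairs of a residue mod [m], moved by [a], and of a level, and a
    reduced word describes a path that starts at residue 0: each syllable goes down one level,
    from [(r, l + 1)] to [(0, l)] after [a^r].  [syl_src s false] lists the
    points that [b] must move for this, and [syl_src s true] their images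
    under [b]: a syllable [(r, true)] uses [b^-1], so there [b] goes up. *)
Fixpoint syl_src (N : nat) (e : bool) (s : seq (int * bool)) :
    seq ('Z_`|m| * 'I_N.+1) :=
  if s is x :: s' then
    (if x.2 == e then (x.1%:~R, inord (size s)) else (0, inord (size s')))
      :: syl_src N e s'
  else [::].

Lemma size_syl_src N e s : size (syl_src N e s) = size s.
Proof. by elim: s => //= x s ->. Qed.

Lemma syl_src_level N e s v : (size s <= N)%N ->
  v \in syl_src N e s -> (v.2 <= size s)%N.
Proof.
elim: s => //= x s IHs sN; rewrite inE => /predU1P[->|/IHs]; last by lia.
by case: eqP => _; rewrite /= inordK //; lia.
Qed.

(** Distinct syllables move distinct points: adjacent ones could only meet at
    the residue 0 of a common level, where reducedness separates them. *)
Lemma syl_src_uniq N e s :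
  (size s <= N)%N -> sorted syl_red s -> uniq (syl_src N e s).
Proof.
elim: s => [|x s IHs] //= sN reds.
rewrite IHs ?(path_sorted reds) ?andbT; [|lia|by []].
case: eqP => [_|xe].
  by apply/negP => /syl_src_level; rewrite /= inordK; lia.
case: s {IHs} sN reds => //= y s sN /andP[redxy _].
rewrite inE negb_or; apply/andP; split; last first.
  by apply/negP => /syl_src_level; rewrite /= inordK; lia.
case: (y.2 =P e) => [ye|_]; last first.
  by rewrite xpair_eqE -[X in _ && X]val_eqE /= !inordK; lia.
rewrite xpair_eqE negb_and; apply/orP; left.
apply: contra redxy; rewrite eq_sym intr_Zp_eq0 // => ->.
by apply/eqP; rewrite ye.
Qed.

(** A finite permutation quotient in which a reduced word of [size s]
    syllables carries a point from level [size s] to level 0. *)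
Lemma BS_level_quotient N s : (size s <= N)%N -> sorted syl_red s ->
  exists h : G -> {perm ('Z_`|m| * 'I_N.+1)}, {morph h : x y / x * y}%g /\
    forall t, h (syl_val s t) (0, inord (size s)) = (t%:~R, inord 0).
Proof.
move=> sN reds.
have [|B] := perm_extending (syl_src_uniq false sN reds)
                            (syl_src_uniq true sN reds).
  by rewrite !size_syl_src.
have shI : injective (fun v : 'Z_`|m| * 'I_N.+1 => (v.1 + 1, v.2)).
  by move=> [v i] [w j] vw; have /addIr/= -> := congr1 fst vw;
     have /= -> := congr1 snd vw.
pose A := perm shI.
have Ak k v : (A ^z k)%g v = (v.1 + k%:~R, v.2).
  have := @perm_expgz_orbit _ A (fun i => (v.1 + i%:~R, v.2)) _ 0 k.
  rewrite addr0 add0r -surjective_pairing; apply=> i.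
  by rewrite permE /= intrD addrA.
have A1 k : (m %| k)%Z -> (A ^z k)%g = 1%g.
  rewrite -intr_Zp_eq0 // => /eqP k0; apply/permP => v.
  by rewrite Ak k0 addr0 perm1 -surjective_pairing.
case: BSab => _ _ /(_ {perm ('Z_`|m| * 'I_N.+1)} A B)[].
  by rewrite !A1 ?dvdz_mull // mul1g mulg1.
move=> h [hM ha hb] Bsrc; exists h; split=> // t.
elim: s Bsrc {sN reds} => [_|[r e] s IHs /= [Bhd /IHs <-]].
  by rewrite /= (morph_expgz hM) ha Ak /= add0r.
rewrite !hM (morph_expgz hM) ha !permM Ak add0r /=; congr (h _ _).
case: e Bhd => /= Bhd; last by rewrite hb.
by rewrite (morph_mulV hM) hb -Bhd permK.
Qed.

Lemma BS_eq_fin_separated (g : G) : g <> 1%g -> fin_separated g.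
Proof.
have [s [t [reds ->]]] := syl_normal_form g.
case: s reds => [_ g1|x s reds _].
  have t0 : t <> 0 by move=> t0; apply: g1; rewrite /syl_val t0.
  rewrite /syl_val /=; apply: (BS_expgz_separated (s := 1) BSab) => //.
  exists eps%:~R, eps%:~R; split; first by rewrite -intrM eps2.
  by rewrite [eps * m]mulrC intrM.
have [h [hM hval]] := BS_level_quotient (leqnn (size (x :: s))) reds.
exists ('Z_`|m| * 'I_(size (x :: s)).+1)%type, h; split=> //.
move=> /permP/(_ (0, inord (size (x :: s)))).
by rewrite hval perm1 => -[_ /(congr1 val)]; rewrite /= !inordK.
Qed.

End BSEqual.

Lemma BS_fin_separated (G : groupType) (a b : G) (m n : int) :
    is_BS a b m n -> m <> 0 -> n <> 0 ->
    `|m| = 1 \/ `|n| = 1 \/ `|m| = `|n| ->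
  forall g : G, g <> 1%g -> fin_separated g.
Proof.
move=> BSab m0 n0 mn.
have caseone (c : G) k l : is_BS a c k l -> l <> 0 -> `|k| = 1 ->
    forall g : G, g <> 1%g -> fin_separated g.
  move=> BSac l0 k1; have [kE|kE] : k = 1 \/ k = -1 by lia.
    by rewrite kE in BSac; apply: BS1_fin_separated BSac l0.
  move/is_BS_opp: BSac; rewrite kE opprK => BSac.
  by apply: BS1_fin_separated BSac _; lia.
have [/eqP m1|m1] := boolP (`|m| == 1); first exact: caseone BSab n0 m1.
have [/eqP n1|n1] := boolP (`|n| == 1).
  exact: caseone (is_BS_swap BSab) m0 n1.
have m_gt1 : (1 < `|m|)%N by lia.
have [nE|nE] : n = 1 * m \/ n = -1 * m by lia.
  by rewrite nE in BSab; apply: BS_eq_fin_separated BSab _ m_gt1.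
by rewrite nE in BSab; apply: BS_eq_fin_separated BSab _ m_gt1.
Qed.

(** * Finite quandle quotients of conjugation quandles *)

Section FiniteQuandleQuotient.
Local Open Scope group_scope.

Variables (G : groupType) (P : finQuandleType) (psi : Conj G -> P).
Hypothesis psiM : quandle_hom psi.

(** Elements of [G] whose conjugation actions are identified by [psi].
    Although [psi] need not respect products, this is a congruence. *)
Definition conj_eqv (g h : G) : Prop :=
  forall x : G, psi (x ^ g : G) = psi (x ^ h : G).

Lemma psi_conjg (x g : G) : psi (x ^ g : G) = psi x *q psi g.
Proof. exact: psiM. Qed.

Lemma psi_conj_eqv (g h : G) : psi g = psi h -> conj_eqv g h.
Proof. by move=> gh x; rewrite !psi_conjg gh. Qed.

Lemma conj_eqvM (g g' h h' : G) :
  conj_eqv g g' -> conj_eqv h h' -> conj_eqv (g * h) (g' * h').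
Proof. by move=> gg' hh' x; rewrite !conjgM hh' psi_conjg gg' -psi_conjg. Qed.

Lemma conj_eqv1V (g : G) : conj_eqv g 1 -> conj_eqv g^-1 1.
Proof.
move=> g1 x; have /esym := g1 (x ^ g^-1).
by rewrite conjgKV !conjg1.
Qed.

Lemma conj_eqvJ (g g' h : G) : conj_eqv g g' -> conj_eqv (g ^ h) (g' ^ h).
Proof.
move=> gg'; have e k : conj_eqv k k by [].
by rewrite !conjgE; apply: conj_eqvM => //; apply: conj_eqvM.
Qed.

Lemma conj_eqv1J (g h : G) : conj_eqv g 1 -> conj_eqv (g ^ h) 1.
Proof. by move=> g1; rewrite -(conj1g h); apply: conj_eqvJ. Qed.

Lemma conj_eqv1X (g : G) (r k : int) :
  conj_eqv (g ^z r) 1 -> conj_eqv (g ^z (r * k)%R) 1.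
Proof.
move=> gr1; rewrite expgzM.
elim/int_up_down_ind: k => [|k IHk|k IHk]; first by [].
  by rewrite expgzS -[X in conj_eqv _ X]mulg1; apply: conj_eqvM.
rewrite expgzB1 -[X in conj_eqv _ X]mulg1; apply: conj_eqvM => //.
exact: conj_eqv1V.
Qed.

(** By the pigeonhole principle [psi] takes equal values at two powers. *)
Lemma conj_eqv_torsion (g : G) :
  exists2 r : nat, (0 < r)%N & conj_eqv (g ^+ r) 1.
Proof.
pose f (i : 'I_#|P|.+1) : P := psi (g ^+ i : G).
have /injectivePn [i [j ij fij]] : ~~ injectiveb f.
  by apply/injectiveP => /leq_card; rewrite card_ord ltnn.
wlog ltij : i j ij fij / (i < j)%N => [th|].
  have [ltij|ltji|/val_inj eij] := ltngtP i j; first exact: th ltij.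
    by apply: (th j i) ltji; rewrite // eq_sym.
  by rewrite eij eqxx in ij.
exists (j - i)%N; first by rewrite subn_gt0.
rewrite expgnFr ?(ltnW ltij) //.
rewrite -(mulgV (g ^+ i)); apply: conj_eqvM => //.
exact: psi_conj_eqv.
Qed.

Lemma conj_eqv_period (g : G) :
  exists2 r : int, r <> 0%R &
    forall k, conj_eqv (g ^z k) 1 <-> (r %| k)%Z.
Proof.
have [r0 r0_gt0 gr0] := conj_eqv_torsion g.
have exP : exists r, (0 < r)%N && `[< conj_eqv (g ^+ r) 1 >].
  by exists r0; rewrite r0_gt0; apply/asboolP.
case: (ex_minnP exP) => r /andP[r_gt0 /asboolP gr1] rmin.
exists r%:Z => [|k]; first by lia.
split=> [gk|/dvdzP[q ->]]; last by rewrite mulrC; apply: conj_eqv1X.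
have rneq0 : r%:Z != 0%R by lia.
have km0 := modz_ge0 k rneq0; have kmr := ltz_mod k rneq0.
have [x xE] : exists x : nat, (k %% r)%Z = x by exists `|(k %% r)%Z|%N; lia.
have gx : conj_eqv (g ^+ x) 1.
  have -> : g ^+ x = g ^z k * g ^z (r%:Z * - (k %/ r)%Z)%R.
    rewrite -expgzD; have := divz_eq k r; rewrite xE.
    by move: (k %/ r)%Z => q kE; rewrite (_ : _ + _ = x%:Z)%R //; lia.
  rewrite -[X in conj_eqv _ X]mulg1; apply: conj_eqvM => //.
  exact: conj_eqv1X.
apply/dvdz_mod0P; rewrite xE; case: x xE gx => // x xE gx.
have := rmin x.+1; rewrite /= => /(_ (asboolT gx)); lia.
Qed.

(** The order of the image of [a] has the same greatest common divisor with
    [m] as with [n], so modulo this order [gcd m n] is a multiple of [m]. *)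
Lemma BS_quandle_collapse (a b : G) (m n : int) :
  a ^z m * b = b * a ^z n ->
  psi (a ^ ((a ^z gcdz m n) ^ b) : G) = psi a.
Proof.
move=> rel; have relJ k : (a ^z (m * k)%R) ^ b = a ^z (n * k)%R.
  by rewrite !expgzM conjgE (expgz_intertwine k rel) mulKg.
have [r r0 rP] := conj_eqv_period a.
have gn : (gcdz m r %| n)%Z.
  have [u uE] := dvdzP (dvdz_gcdl m r).
  have [v vE] := dvdzP (dvdz_gcdr m r).
  have v0 : v <> 0%R by move=> v0; apply: r0; rewrite vE v0 mul0r.
  have /rP/conj_eqv1J : (r %| (m * v)%R)%Z.
    by apply/dvdzP; exists u; rewrite {1}uE {2}vE mulrAC mulrA.
  move/(_ b); rewrite relJ => /rP/dvdzP[w wE]; apply/dvdzP; exists w.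
  apply: (@mulIf _ v); first exact/eqP.
  by rewrite wE {1}vE mulrCA mulrC.
have [u [v uv]] := Bezoutz m r.
have /dvdzP[c cE] : (gcdz m r %| gcdz m n)%Z by rewrite dvdz_gcd dvdz_gcdl.
have dE : conj_eqv (a ^z gcdz m n) (a ^z (m * (c * u))%R).
  rewrite cE -uv mulrDr expgzD -[X in conj_eqv _ X]mulg1.
  rewrite (_ : c * (u * m) = m * (c * u))%R; last by ring.
  by apply: conj_eqvM => //; apply/rP; rewrite mulrA dvdz_mull.
rewrite (conj_eqvJ b dE) relJ.
congr psi; rewrite conjgE.
by rewrite -(expgz_intertwine _ (erefl (a * a))) mulKg.
Qed.

End FiniteQuandleQuotient.

(** * An infinite permutation action of BS(m, n) *)

Section IntNatBijections.

(** The translation by 1 of the integers; its orbits on the pairs are indexed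
    by the natural numbers. *)
Definition shift_bij : selfbij (int * nat) :=
  @SelfBij (int * nat) (fun v => (v.1 + 1, v.2)) (fun v => (v.1 - 1, v.2))
    ltac:(by move=> [q t]; rewrite /= addrK)
    ltac:(by move=> [q t]; rewrite /= subrK).

Fact swap_natK (i j : nat) :
  involutive (fun x : nat => if x == i then j else if x == j then i else x).
Proof.
move=> x /=; have [->|xi] := eqVneq x i; first by rewrite !eqxx; case: eqVneq.
have [->|xj] := eqVneq x j; first by rewrite !eqxx.
by rewrite (negPf xi) (negPf xj).
Qed.

(** The transposition of [i] and [j]. *)
Definition swap_nat (i j : nat) : selfbij nat :=
  SelfBij (swap_natK i j) (swap_natK i j).

Lemma swap_natL i j : swap_nat i j i = j.
Proof. by rewrite /= eqxx. Qed.

Lemma swap_natR i j : swap_nat i j j = i.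
Proof. by rewrite /= eqxx; case: eqVneq. Qed.

Lemma swap_natD i j x : x <> i -> x <> j -> swap_nat i j x = x.
Proof. by rewrite /= => /eqP/negPf-> /eqP/negPf->. Qed.

(** The permutation [s] of the orbits of the translation. *)
Definition fiber_bij (s : selfbij nat) : selfbij (int * nat) :=
  @SelfBij (int * nat) (fun v => (v.1, s v.2)) (fun v => (v.1, sb_inv s v.2))
    ltac:(by move=> [q t]; rewrite /= sb_funK)
    ltac:(by move=> [q t]; rewrite /= sb_invK).

Variables (m : int) (m_neq0 : m <> 0).

(** Each orbit of the translation is made of |m| orbits of its [m]-th power,
    one for each residue modulo [m].  Numbering all of these by the natural
    numbers gives a bijection that carries the [m]-th power of the
    translation to the translation itself (see [split_bij_shift]). *)
Definition split_fun (v : int * nat) : int * nat :=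
  ((v.1 %/ m)%Z, (`|m| * v.2 + `|(v.1 %% m)%Z|)%N).

Definition split_inv (v : int * nat) : int * nat :=
  (v.1 * m + (v.2 %% `|m|)%N%:Z, (v.2 %/ `|m|)%N).

Lemma split_val (q : int) (r t : nat) : (r < `|m|)%N ->
  split_fun (q * m + r%:Z, t) = (q, (`|m| * t + r)%N).
Proof.
move=> rm; rewrite /split_fun /=.
have r_small : (0 <= r%:Z < `|m|)%R by lia.
rewrite divzMDl; last exact/eqP.
have rE := divz_eq r m; rewrite divz_small // mul0r add0r in rE.
by rewrite divz_small // addr0 modzMDl -rE.
Qed.

Lemma split_funK : cancel split_fun split_inv.
Proof.
move=> [x t]; rewrite /split_fun /split_inv /=.
have m0 : m != 0 by exact/eqP.
have := modz_ge0 x m0; have := ltz_mod x m0 => xm x0.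
have [r rE] : exists r : nat, (x %% m)%Z = r by exists `|(x %% m)%Z|%N; lia.
rewrite rE absz_nat in xm *.
rewrite mulnC modnMDl divnMDl; last by lia.
have r_small : (r < `|m|)%N by lia.
by rewrite modn_small // divn_small // addn0 -rE -divz_eq.
Qed.

Lemma split_invK : cancel split_inv split_fun.
Proof.
move=> [q N]; rewrite /split_inv split_val /=; last by rewrite ltn_mod; lia.
by rewrite mulnC -divn_eq.
Qed.

Definition split_bij : selfbij (int * nat) := SelfBij split_funK split_invK.

Lemma shift_bij_expgz k v : (shift_bij ^z k)%g v = (v.1 + k, v.2).
Proof.
have := @expgz_act _ _ (fun v (g : selfbij (int * nat)) => g v) shift_bij
  (fun i => (v.1 + i, v.2)) _ _ _ 0 k.
rewrite /= addr0 add0r -surjective_pairing; apply=> // i.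
by rewrite /= addrA.
Qed.

Lemma split_bij_shift :
  (shift_bij ^z m * split_bij = split_bij * shift_bij)%g.
Proof.
apply: selfbij_ext => v.
rewrite -[LHS]/(split_fun ((shift_bij ^z m)%g v)) shift_bij_expgz.
rewrite -[RHS]/(shift_bij (split_fun v)) /split_fun /=.
rewrite (_ : v.1 + m = 1 * m + v.1); last by rewrite mul1r addrC.
by rewrite modzMDl divzMDl 1?[1 + _]addrC //; apply/eqP.
Qed.

End IntNatBijections.

(** With [E_m] the bijection [split_bij] for [m], the element [b] will act by
    [E_m], then a permutation [s] of the orbits, then the inverse of [E_n];
    [s] is free, and the values below are those needed for
    [b^-1 a^d b] not to commute with [a]. *)
Lemma nat_bij_split (k d : nat) : (0 < d < k)%N ->
  exists s : selfbij nat,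
    [/\ s 0%N = 0%N, s k = 1%N & s (k + d)%N <> (s d).+1].
Proof.
move=> /andP[d_gt0 dk].
exists (swap_nat 1 k * swap_nat (k + d) (k + d).+1)%g.
have sE x : (swap_nat 1 k * swap_nat (k + d) (k + d).+1)%g x =
  swap_nat (k + d) (k + d).+1 (swap_nat 1 k x) by [].
split; rewrite !sE.
- by rewrite !swap_natD; lia.
- by rewrite swap_natR swap_natD; lia.
rewrite [swap_nat 1 k (k + d)%N]swap_natD; [|lia..].
rewrite swap_natL; have [->|d1] := eqVneq d 1%N.
  by rewrite swap_natL swap_natD; lia.
by rewrite !swap_natD; lia.
Qed.

(** The elements [a] and [b^-1 a^d b] do not commute, as they act on (0, 0)
    in different ways according to the order. *)
Lemma BS_conj_neq (G : groupType) (a b : G) (m n : int) (d : nat) :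
    is_BS a b m n -> (0 < d < `|m|)%N -> (1 < `|n|)%N ->
  (a ^ ((a ^z d) ^ b))%g <> a.
Proof.
move=> BSab /andP[d_gt0 dm] n_gt1.
have m0 : m <> 0 by lia.
have n0 : n <> 0 by lia.
have [|s [s0 sm sd]] := @nat_bij_split `|m| d; first by rewrite d_gt0.
pose A := shift_bij; pose E := split_bij m0; pose F := split_bij n0.
pose S := fiber_bij s; pose B : selfbij (int * nat) := (E * S * F^-1)%g.
case: BSab => _ _ /(_ _ A B)[].
  rewrite /B !mulgA split_bij_shift -(mulgA E A S).
  have -> : (A * S = S * A)%g by exact: selfbij_ext.
  rewrite -!mulgA; congr (_ * (_ * _))%g.
  exact: expgz_intertwineV (split_bij_shift n0).
move=> h [hM ha hb] aa.
pose g : selfbij (int * nat) := (B^-1 * ((A ^z d) * B))%g.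
have gA : (A * g = g * A)%g.
  have <- : h ((a ^z d) ^ b)%g = g.
    by rewrite conjgE !hM (morph_mulV hM) (morph_expgz hM) ha hb.
  by rewrite -ha -!hM conjgC aa.
have Bval (r t : nat) : (r < `|m|)%N ->
    B (r%:Z, t) = split_inv n (0, s (`|m| * t + r)%N).
  move=> rm; rewrite -[LHS]/(split_inv n ((split_fun m (r%:Z, t)).1,
    s (split_fun m (r%:Z, t)).2)).
  by have := split_val m0 0 t rm; rewrite mul0r add0r => ->.
have gval (x : int * nat) (t : nat) : B (0, t) = x ->
    g x = split_inv n (0, s (`|m| * t + d)%N).
  move=> <-; rewrite -[LHS]/(B ((A ^z d)%g (sb_inv B (B (0, t))))) sb_funK.
  by rewrite shift_bij_expgz add0r Bval.
(* b^-1 fixes (0, 0) and carries (1, 0) to (0, 1); a^d b then leads to the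
   numbers s d and s (|m| + d). *)
have := congr1 (fun f : selfbij (int * nat) => f (0, 0%N)) gA.
rewrite -[LHS]/(g (1, 0%N)) -[RHS]/(A (g (0, 0%N))).
rewrite (gval (1, 0%N) 1%N); last first.
  rewrite Bval ?muln1 ?addn0 ?sm; last by lia.
  by rewrite /split_inv /= mul0r add0r modn_small // divn_small.
rewrite (gval (0, 0%N) 0%N); last first.
  rewrite Bval ?muln0 ?addn0 ?s0; last by lia.
  by rewrite /split_inv /= mul0r add0r mod0n div0n.
rewrite muln1 muln0 add0n.
rewrite /split_inv /= !mul0r !add0r => -[mod_eq div_eq].
apply: sd.
rewrite (divn_eq (s (`|m| + d)%N) `|n|) mod_eq div_eq.
by rewrite addnA -divn_eq addn1.
Qed.

(** * Residual finiteness of the conjugation quandle *)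

Lemma BS_not_residually_finite (G : groupType) (a b : G) (m n : int) :
    is_BS a b m n -> ~~ (m %| n)%Z -> (1 < `|n|)%N -> m <> 0 ->
  ~ quandle_residually_finite (Conj G).
Proof.
move=> BSab mn n_gt1 m0 rf; pose d := `|gcdz m n|%N.
have dE : gcdz m n = d by [].
have d_gt0 : (0 < d)%N by rewrite /d absz_gt0 gcdz_eq0; lia.
have dm : (d < `|m|)%N.
  rewrite ltn_neqAle dvdn_leq ?absz_gt0 ?dvdn_gcdl ?andbT //; last exact/eqP.
  by apply: contra mn => /eqP dm; apply/gcdz_idPl; rewrite dE dm.
have [|P [psi [psiM neq]]] := rf (a ^ ((a ^z d) ^ b))%g a.
  by apply: BS_conj_neq BSab _ n_gt1; rewrite d_gt0.
by case: BSab neq => _ rel _ []; rewrite -dE; apply: BS_quandle_collapse.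
Qed.

Theorem theorem4p1 (m n : int) (m_neq0 : m <> 0) (n_neq0 : n <> 0) :
  quandle_residually_finite (Conj (BS m n)) <->
  `|m| = 1 \/ `|n| = 1 \/ `|m| = `|n|.
Proof.
have BSab := BS_is_BS m n; split=> [rf | mn]; last first.
  exact: Conj_residually_finite (BS_fin_separated BSab m_neq0 n_neq0 mn).
have [m1|m1] := eqVneq `|m| 1; first by left.
have [n1|n1] := eqVneq `|n| 1; first by right; left.
right; right.
have [mn|mn] := boolP (m %| n)%Z; last first.
  by case: (BS_not_residually_finite BSab mn _ m_neq0 rf); lia.
have [nm|nm] := boolP (n %| m)%Z; last first.
  by case: (BS_not_residually_finite (is_BS_swap BSab) nm _ n_neq0 rf); lia.
rewrite -!abszE; congr Posz.
by apply/eqP; rewrite eqn_dvd; apply/andP; split.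
Qed.
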